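(* Let $K$ be a $^*$-continuous KAT with top, $A$ a top Kleene abstract domain of $K$ with maps $\alpha,\gamma$, and $T_{\Sigma,B}$ a KAT language interpreted on $K$. Consider $\mathrm{LCTK}_A$ extended with the rule (limit), and let $t\in T_{\Sigma,B}$ be such that $A$ is globally complete for $\llbracket\mathtt b\rrbracket_u$ for every atom $\mathtt b$ occurring in $t$. For all $a,b\in K$, if $[a]\,t\,[b]$ is valid, i.e. $\top b\le\top a\llbracket t\rrbracket_u$ and $\mathcal S^\sharp[t]\,\alpha(\top a)=\alpha(\top b)=\alpha(\top a\llbracket t\rrbracket_u)$, then $[a]\,t\,[b]$ is derivable.
   Context: Idempotent semiring: $(K,+,0)$ commutative monoid with $a+a=a$, $(K,\cdot,1)$ monoid, two-sided distributivity, $0a=a0=0$; $a\le b$ iff $a+b=b$. KAT: idempotent semiring with Boolean subalgebra $\mathrm{Test}(K)$ (join $+$, meet $\cdot$, complement, bottom $0$, top $1$) and ${}^*$ with $1+aa^*\le a^*$, $1+a^*a\le a^*$, $b+ac\le c\Rightarrow a^*b\le c$, $b+ca\le c\Rightarrow ba^*\le c$. TopKAT: KAT with greatest element $\top$; $^*$-continuous: $\bigvee_nab^nc$ exists and equals $ab^*c$ for all $a,b,c$. $\mathrm{TOP}(K)=\{\top a\mid a\in K\}$. Language: disjoint $\Sigma,B$ ($\mathtt0,\mathtt1\in B$), $\mathrm{Atom}=\Sigma\cup B$, terms $t::=\mathtt a\mid\mathtt0\mid\mathtt1\mid t_1+t_2\mid t_1\cdot t_2\mid t^*$; evaluation $u:\mathrm{Atom}\to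 K$ with $u(B)\subseteq\mathrm{Test}(K)$, extended homomorphically to $\llbracket\cdot\rrbracket_u$. Top Kleene abstract domain: poset $A$, Galois insertion $\alpha:\mathrm{TOP}(K)\to A$, $\gamma:A\to\mathrm{TOP}(K)$ ($\alpha(x)\le_Ay\iff x\le\gamma(y)$, $\alpha\gamma=\mathrm{id}$), countably complete. Abstract semantics: $\mathcal S^\sharp[\mathtt c]x=\alpha(\gamma(x)\llbracket\mathtt c\rrbracket_u)$, $\mathcal S^\sharp[t_1+t_2]x=\mathcal S^\sharp[t_1]x\vee_A\mathcal S^\sharp[t_2]x$, $\mathcal S^\sharp[t_1\cdot t_2]x=\mathcal S^\sharp[t_2](\mathcal S^\sharp[t_1]x)$, $\mathcal S^\sharp[t^*]x=\bigvee_n(\mathcal S^\sharp[t])^nx$. $A(x):=\gamma\alpha(x)$ for $x\in\mathrm{TOP}(K)$. $\mathbb C^A_b(c)$ iff $A(\top bc)=A(A(\top b)c)$; $A$ is globally complete for $c$ iff $\mathbb C^A_b(c)$ for all $b\in K$. $\mathrm{LCTK}_A$ rules: (transfer) $\mathtt c\in\mathrm{Atom}$, $\mathbb C^A_a(\llbracket\mathtt c\rrbracket_u)$ $\vdash[a]\mathtt c[a\llbracket\mathtt c\rrbracket_u]$; (relax) $\top a'\le\top a\le A(\top a')$, $[a']t[b']$, $\top b\le\top b'\le A(\top b)$ $\vdash[a]t[b]$; (seq) $[a]t_1[r]$, $[r]t_2[b]$ $\vdash[a]t_1\cdot t_2[b]$; (join) $[a]t_1[b_1]$, $[a]t_2[b_2]$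 $\vdash[a]t_1+t_2[b_1+b_2]$; (rec) $[a]t[r]$, $[a+r]t^*[b]$ $\vdash[a]t^*[b]$; (iterate) $[a]t[b]$, $\top b\le A(\top a)$ $\vdash[a]t^*[a+b]$. Rule (limit): from $[a_n]t[a_{n+1}]$ for all $n\in\mathbb N$ infer $[a_0]t^*[\bigvee_na_n]$, applicable only when $\bigvee_na_n$ exists in $K$ and $\top\bigvee_na_n=\bigvee_n\top a_n$. *)

(* Defs.v *)
From HB Require Import structures.
From mathcomp Require Import all_boot all_order all_algebra.
From mathcomp Require Import boolp classical_sets functions cardinality.

Set Implicit Arguments.
Unset Strict Implicit.
Unset Printing Implicit Defensive.

Import Order.TTheory GRing.Theory.

Local Open Scope classical_set_scope.
Local Open Scope ring_scope.

HB.mixin Record isIdemSemiRing K of GRing.PzSemiRing K := {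
  addkk : forall a : K, a + a = a
}.

#[short(type="idemSemiRingType")]
HB.structure Definition IdemSemiRing :=
  { K of GRing.PzSemiRing K & isIdemSemiRing K }.

Definition lek (K : idemSemiRingType) (a b : K) : Prop := a + b = b.

Notation "a <=K b" := (lek a b) (at level 70, no associativity).

(* The least upper bound of S exists and is s. *)
Definition is_lub (K : idemSemiRingType) (S : set K) (s : K) : Prop :=
  (forall x, S x -> x <=K s) /\
  (forall y, (forall x, S x -> x <=K y) -> s <=K y).

(* [compl] is total, but is constrained on tests only. *)
Record boolean_subalgebra (K : pzSemiRingType) (T : set K) (compl : K -> K) :
    Prop := BooleanSubalgebra {
  test0 : T 0;
  test1 : T 1;
  testD : forall p q, T p -> T q -> T (p + q);
  testM : forall p q, T p -> T q -> T (p * q);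
  testN : forall p, T p -> T (compl p);
  testMC : forall p q, T p -> T q -> p * q = q * p;
  testDK : forall p q, T p -> T q -> p * (p + q) = p;
  testMK : forall p q, T p -> T q -> p + p * q = p;
  testDM : forall p q r, T p -> T q -> T r -> p + q * r = (p + q) * (p + r);
  testDN : forall p, T p -> p + compl p = 1;
  testMN : forall p, T p -> p * compl p = 0
}.

HB.mixin Record isKAT K of IdemSemiRing K := {
  Test : set K;
  compl : K -> K;
  test_boolean : boolean_subalgebra Test compl;
  star : K -> K;
  star_unfoldl : forall a : K, 1 + a * star a <=K star a;
  star_unfoldr : forall a : K, 1 + star a * a <=K star a;
  star_inductl : forall a b c : K, b + a * c <=K c -> star a * b <=K c;
  star_inductr : forall a b c : K, b + c * a <=K c -> b * star a <=K c
}.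

#[short(type="katType")]
HB.structure Definition KAT := { K of IdemSemiRing K & isKAT K }.

HB.mixin Record hasTop K of IdemSemiRing K := {
  top : K;
  lek_top : forall a : K, a <=K top
}.

#[short(type="topKatType")]
HB.structure Definition TopKAT := { K of KAT K & hasTop K }.

Definition star_continuous (K : katType) : Prop :=
  forall a b c : K,
    is_lub (range (fun n : nat => a * b ^+ n * c)) (a * star b * c).

Definition TOP (K : topKatType) : set K := range (fun a : K => top * a).
Arguments TOP K : clear implicits.

Section Top.
Variable (K : topKatType).

Lemma topmul_subproof (a : K) : top * a \in TOP K.
Proof. by apply/mem_set; exists a. Qed.

Definition topmul (a : K) : TOP K := exist _ (top * a) (topmul_subproof a).

Lemma TOPmulr_subproof (x : TOP K) (c : K) : val x * c \in TOP K.
Proof.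
case: x => x /= /set_mem[a _ <-]; apply/mem_set.
by exists (a * c) => //; rewrite mulrA.
Qed.

Definition TOPmulr (x : TOP K) (c : K) : TOP K :=
  exist _ (val x * c) (TOPmulr_subproof x c).

End Top.

(* Disjointness of the action symbols Sigma and the test symbols B is enforced
   by the sum type.  The constants 0 and 1 are elements of B, hence atoms, so
   they need no separate term constructors: see [evaluation]. *)
Definition atom (Sigma B : Type) : Type := (Sigma + B)%type.

Inductive term (Sigma B : Type) : Type :=
  | TAtom of atom Sigma B
  | TAdd of term Sigma B & term Sigma B
  | TMul of term Sigma B & term Sigma B
  | TStar of term Sigma B.

Fixpoint occurs (Sigma B : Type) (c : atom Sigma B) (t : term Sigma B) : Prop :=
  match t with
  | TAtom c' => c = c'
  | TAdd t1 t2 | TMul t1 t2 => occurs c t1 \/ occurs c t2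
  | TStar t1 => occurs c t1
  end.

(* b0 and b1 are the symbols 0 and 1 of B. *)
Record evaluation (K : katType) (Sigma B : Type)
    (b0 b1 : B) (u : atom Sigma B -> K) : Prop := Evaluation {
  eval_test : forall b : B, Test (u (inr b));
  eval_zero : u (inr b0) = 0;
  eval_one : u (inr b1) = 1
}.

Fixpoint sem (K : katType) (Sigma B : Type)
    (u : atom Sigma B -> K) (t : term Sigma B) : K :=
  match t with
  | TAtom c => u c
  | TAdd t1 t2 => sem u t1 + sem u t2
  | TMul t1 t2 => sem u t1 * sem u t2
  | TStar t1 => star (sem u t1)
  end.

Record top_kleene_domain (d : Order.disp_t) (K : topKatType)
    (A : porderType d) (alpha : TOP K -> A) (gamma : A -> TOP K) : Prop :=
  TopKleeneDomain {
    galois_connection : forall (x : TOP K) (y : A),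
      (alpha x <= y)%O <-> val x <=K val (gamma y);
    galois_insertion : forall y : A, alpha (gamma y) = y;
    countably_complete : forall S : set A, countable S -> supremums S !=set0
  }.

(* The first argument of [supremum] is a default value, irrelevant here as soon
   as the joins exist. *)
Definition bjoin (d : Order.disp_t) (A : porderType d) (x y : A) : A :=
  supremum x [set x; y].

Definition cjoin (d : Order.disp_t) (A : porderType d) (s : nat -> A) : A :=
  supremum (s 0%N) (range s).

Section LCTK.
Variables (d : Order.disp_t) (K : topKatType) (A : porderType d).
Variables (alpha : TOP K -> A) (gamma : A -> TOP K).
Variables (Sigma B : Type) (u : atom Sigma B -> K).

Fixpoint abs_sem (t : term Sigma B) (x : A) : A :=
  match t with
  | TAtom c => alpha (TOPmulr (gamma x) (u c))
  | TAdd t1 t2 => bjoin (abs_sem t1 x) (abs_sem t2 x)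
  | TMul t1 t2 => abs_sem t2 (abs_sem t1 x)
  | TStar t1 => cjoin (fun n => iter n (abs_sem t1) x)
  end.

Definition Acl (x : TOP K) : TOP K := gamma (alpha x).

Definition locally_complete (b c : K) : Prop :=
  Acl (topmul (b * c)) = Acl (TOPmulr (Acl (topmul b)) c).

Definition globally_complete (c : K) : Prop :=
  forall b : K, locally_complete b c.

Definition valid (a : K) (t : term Sigma B) (b : K) : Prop :=
  [/\ top * b <=K top * a * sem u t,
      abs_sem t (alpha (topmul a)) = alpha (topmul b) &
      alpha (topmul b) = alpha (TOPmulr (topmul a) (sem u t))].

Inductive derivable : K -> term Sigma B -> K -> Prop :=
  | d_transfer (a : K) (c : atom Sigma B) :
      locally_complete a (u c) ->
      derivable a (TAtom c) (a * u c)
  | d_relax (a a' b b' : K) (t : term Sigma B) :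
      top * a' <=K top * a ->
      top * a <=K val (Acl (topmul a')) ->
      derivable a' t b' ->
      top * b <=K top * b' ->
      top * b' <=K val (Acl (topmul b)) ->
      derivable a t b
  | d_seq (a r b : K) (t1 t2 : term Sigma B) :
      derivable a t1 r -> derivable r t2 b -> derivable a (TMul t1 t2) b
  | d_join (a b1 b2 : K) (t1 t2 : term Sigma B) :
      derivable a t1 b1 -> derivable a t2 b2 ->
      derivable a (TAdd t1 t2) (b1 + b2)
  | d_rec (a r b : K) (t : term Sigma B) :
      derivable a t r -> derivable (a + r) (TStar t) b ->
      derivable a (TStar t) b
  | d_iterate (a b : K) (t : term Sigma B) :
      derivable a t b -> top * b <=K val (Acl (topmul a)) ->
      derivable a (TStar t) (a + b)
  | d_limit (a : nat -> K) (s : K) (t : term Sigma B) :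
      (forall n : nat, derivable (a n) t (a n.+1)) ->
      is_lub (range a) s ->
      is_lub (range (fun n : nat => top * a n)) (top * s) ->
      derivable (a 0%N) (TStar t) s.

End LCTK.

(* Main.v *)
Require Import Defs.
From mathcomp Require Import all_boot all_order all_algebra.
From mathcomp Require Import boolp classical_sets.

Import Order.TTheory GRing.Theory.
Local Open Scope ring_scope.

(** Global completeness makes the exact triple [a] t [a ⟦t⟧] derivable for every
    precondition a.  For a star, (limit) applies to the sequence a ⟦t⟧^n:
    *-continuity, used once for a and once for ⊤a, provides both required least
    upper bounds.  A valid postcondition b has the same abstraction as a ⟦t⟧ and
    lies below it, hence is reached by (relax). *)

Lemma lekk (K : idemSemiRingType) (a : K) : a <=K a.
Proof. exact: addkk. Qed.

Lemma star_continuous_lub (K : katType) (hK : star_continuous K) (a b : K) :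
  is_lub (range (fun n : nat => a * b ^+ n)) (a * star b).
Proof.
have := hK a b 1; rewrite mulr1.
by under eq_fun do rewrite mulr1.
Qed.

(** The Galois connection taken at [alpha x], where its abstract side is reflexivity. *)
Lemma lek_Acl (d : Order.disp_t) (K : topKatType) (A : porderType d)
  (alpha : TOP K -> A) (gamma : A -> TOP K)
  (hA : top_kleene_domain alpha gamma) (x : TOP K) :
  val x <=K val (Acl alpha gamma x).
Proof. by apply/(galois_connection hA). Qed.

Lemma derivable_sem (d : Order.disp_t) (K : topKatType) (A : porderType d)
  (alpha : TOP K -> A) (gamma : A -> TOP K)
  (Sigma B : Type) (u : atom Sigma B -> K)
  (hK : star_continuous K) (t : term Sigma B)
  (ht : forall c : atom Sigma B,
      occurs c t -> globally_complete alpha gamma (u c)) (a : K) :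
  derivable alpha gamma u a t (a * sem u t).
Proof.
(* The precondition stays general: (seq) needs the hypothesis for [t2] at a ⟦t1⟧, and (limit) needs
   it at every a ⟦t⟧^n. *)
elim: t ht a => [c|t1 IH1 t2 IH2|t1 IH1 t2 IH2|t IH] /= ht a.
- by apply: d_transfer; apply: ht.
- rewrite mulrDr; apply: d_join.
  + by apply: IH1 => c hc; apply: ht; left.
  + by apply: IH2 => c hc; apply: ht; right.
- rewrite mulrA; apply: (d_seq (r := a * sem u t1)).
  + by apply: IH1 => c hc; apply: ht; left.
  + by apply: IH2 => c hc; apply: ht; right.
(* (limit) starts from the term of index 0, so the precondition [a] is displayed as a ⟦t⟧^0. *)
- rewrite -[X in derivable _ _ _ X](mulr1 a) -[X in a * X](expr0 (sem u t)).
  apply: (d_limit (a := fun n => a * sem u t ^+ n)) => [n||].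
  + by rewrite exprSr mulrA; apply: IH.
  + exact: star_continuous_lub.
  + under eq_fun do rewrite mulrA.
    by rewrite mulrA; apply: star_continuous_lub.
Qed.

Theorem theorem10 (d : Order.disp_t) (K : topKatType) (A : porderType d)
  (alpha : TOP K -> A) (gamma : A -> TOP K)
  (Sigma B : Type) (b0 b1 : B) (u : atom Sigma B -> K)
  (hK : star_continuous K)
  (hA : top_kleene_domain alpha gamma)
  (hu : evaluation b0 b1 u)
  (t : term Sigma B)
  (ht : forall c : atom Sigma B, occurs c t -> globally_complete alpha gamma (u c)) :
  forall a b : K, valid alpha gamma u a t b -> derivable alpha gamma u a t b.
Proof.
move=> a b [le_b _ alpha_b].
apply: (d_relax (a' := a) (b' := a * sem u t)).
- exact: lekk.
- exact: (lek_Acl _ _ _ _ _ hA (topmul a)).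
- exact: derivable_sem.
- by rewrite mulrA.
(* Equal abstractions have equal closures, so what remains is that ⊤a⟦t⟧ lies below its own
   closure. *)
- rewrite mulrA /Acl alpha_b.
  exact: (lek_Acl _ _ _ _ _ hA (TOPmulr (topmul a) (sem u t))).
Qed.
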